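(* Let $f:\mathbb{R}^n\to\mathbb{R}$ be convex, continuously differentiable and locally strongly convex with locally Lipschitz gradient, with $\mathcal{X}^*:=\arg\min f\neq\emptyset$ and optimal value $f^*$. Fix $x^0$, $\alpha_0>0$, $\theta_0>0$, $\tau>1$, $0<\omega\le\frac1{\sqrt2}$, $\gamma_k\in[\gamma_{\min},\gamma_{\max}]\subset(0,\infty)$, and generate $x^{k+1}=x^k-\alpha_k\gamma_k\nabla f(x^k)$ with, for $k\ge1$, $L_k:=\frac{\|\nabla f(x^k)-\nabla f(x^{k-1})\|}{\|x^k-x^{k-1}\|}$, $\alpha_k:=\min\{\frac{\alpha_{k-1}\gamma_{k-1}}{\gamma_k}\sqrt{2(1-\omega^2)+\theta_{k-1}/\tau},\frac{\omega}{\gamma_kL_k}\}$, $\theta_k:=\frac{\alpha_k\gamma_k}{\alpha_{k-1}\gamma_{k-1}}$. Let $\eta:=\mathrm{dist}^2(x^0;\mathcal{X}^* )+2\alpha_0^2\gamma_0^2\|\nabla f(x^0)\|^2+2\alpha_0\gamma_0\theta_0(f(x^0)-f^* )$, $W:=\overline B(0;R)$ with $R>3\sqrt\eta+\mathrm{dist}(x^0;\mathcal{X}^* )+\|x^0\|$, $L_W>0$ a Lipschitz constant of $\nabla f$ on $W$, $\mu_W:=\inf_{x,y\in W,x\neq y}\frac{\langle\nabla f(y)-\nabla f(x),y-x\rangle}{\|y-x\|^2}$, $m:=\min\{\frac{\alpha_0\gamma_0\mu_W}{\omega},\frac{\mu_W}{L_W}\}$ and $\hat q:=\min\{\frac{\mu_W}{2}\min\{\alpha_0\gamma_0,\frac{\omega}{L_W}\},\frac{\mu_W(1-\omega^2)}{2\omega^3L_W+\mu_W(1-\omega^2)},\frac{(\tau-1)m}{\tau(2(1-\omega^2)+m)}\}$.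 Let $x^*\in\mathcal{X}^*$, $$\tilde c_1:=\sqrt{(R+\|x^0\|)^2+\eta},\quad\tilde c_2:=\frac{\omega L_W^2\tilde c_1^2}{\mu_W\min\{\alpha_0^2\gamma_0^2L_W^2,\omega^2\}},\quad \tilde c_3:=\frac{\sqrt{2\tilde c_1^2(1-\omega^2)\omega L_W^3}}{\sqrt{2\omega^2L_W+(1-\omega^2)\mu_W}\,\min\{\alpha_0\gamma_0L_W,\omega\}}.$$ Then for all $k\in\mathbb{N}_0$: $\|x^{k+1}-x^*\|\le\tilde c_1(\sqrt{1-\hat q})^k$, $f(x^k)-f^*\le\tilde c_2(1-\hat q)^k$, and $\|\nabla f(x^k)\|\le\tilde c_3(\sqrt{1-\hat q})^k$.
   Context: AdaSGA setting. $f$ is locally strongly convex if every $x$ has $\delta_x>0$, $\mu_x>0$ with $f(y)\ge f(z)+\langle\nabla f(z),y-z\rangle+\frac{\mu_x}{2}\|y-z\|^2$ for all $y,z\in B(x;\delta_x)$. *)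

(* Defs.v *)
From HB Require Import structures.
From mathcomp Require Import all_boot all_order all_algebra.
From mathcomp Require Import all_classical all_reals all_analysis.
Set Implicit Arguments. Unset Strict Implicit. Unset Printing Implicit Defensive.
Import Order.TTheory GRing.Theory Num.Theory.
Import numFieldNormedType.Exports.
Local Open Scope classical_set_scope.
Local Open Scope ring_scope.

Section Defs.
Variables (R : realType) (n : nat).
Notation V := 'rV[R]_n.

Definition dot (u v : V) : R := \sum_(i < n) u ord0 i * v ord0 i.
Definition enorm (u : V) : R := Num.sqrt (dot u u).

Definition is_gradient (f : V -> R) (g : V -> V) : Prop :=
  forall x, differentiable f x /\ forall h, 'd f x h = dot (g x) h.

Definition convexf (f : V -> R) : Prop :=
  forall (x y : V) (t : R), 0 <= t <= 1 ->
    f (t *: x + (1 - t) *: y) <= t * f x + (1 - t) * f y.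

Definition locally_strongly_convex (f : V -> R) (g : V -> V) : Prop :=
  forall x : V, exists d : R, exists mu : R, 0 < d /\ 0 < mu /\
    forall y z : V, enorm (y - x) < d -> enorm (z - x) < d ->
      f z + dot (g z) (y - z) + mu / 2 * enorm (y - z) ^+ 2 <= f y.

Definition locally_lipschitz (g : V -> V) : Prop :=
  forall x : V, exists d : R, exists L : R, 0 < d /\
    forall y z : V, enorm (y - x) < d -> enorm (z - x) < d ->
      enorm (g y - g z) <= L * enorm (y - z).

Definition argminset (f : V -> R) : set V := [set x | forall y, f x <= f y].

Definition fstar (f : V -> R) : R := inf (range f).

Definition setdist (x : V) (S : set V) : R := inf [set enorm (x - z) | z in S].

Definition cball0 (r : R) : set V := [set x | enorm x <= r].

Definition lipschitz_const_on (g : V -> V) (W : set V) (L : R) : Prop :=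
  forall x y, W x -> W y -> enorm (g x - g y) <= L * enorm (x - y).

Definition muW (g : V -> V) (W : set V) : R :=
  inf [set r | exists x y, W x /\ W y /\ x <> y /\
                 r = dot (g y - g x) (y - x) / enorm (y - x) ^+ 2].

(* L_k for k >= 1, written L_{k+1} here: ratio of gradient and iterate differences *)
Definition Lk (g : V -> V) (x : nat -> V) (k : nat) : R :=
  enorm (g (x k.+1) - g (x k)) / enorm (x k.+1 - x k).

(* alpha_{k+1} from alpha_k, gamma_k, theta_k, gamma_{k+1}, L_{k+1};
   when L_{k+1} = 0 the second term omega/(gamma L) is +infinity (convention). *)
Definition next_alpha (omega tau alpha_k gamma_k theta_k gamma_k1 L : R) : R :=
  let A := alpha_k * gamma_k / gamma_k1 *
           Num.sqrt (2 * (1 - omega ^+ 2) + theta_k / tau) in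
  if L == 0 then A else Num.min A (omega / (gamma_k1 * L)).

End Defs.

(* Main.v *)
(* With step sizes s_k = alpha_k gamma_k, w = 1 - omega^2, D_k = f(x_k) - f* and
   g_k = grad f(x_k), the energy
     E_k = w |x_{k+1} - x*|^2 + omega^2 s_k^2 |g_k|^2 + s_k (2 w + theta_k) D_k
   is nonincreasing and E_0 <= w eta, so all iterates stay in the ball W.  On W the
   modulus mu_W is positive by compactness, and mu_W <= L_k <= L_W bounds the steps from
   both sides.  Averaging strong convexity and cocoercivity leaves room to add
   w mu_W / (2 omega L_W) s_k^2 |g_k|^2 to E_k, and the sum contracts by 1 - qhat, one
   entry of the minimum qhat for each of its three terms.  This only holds from the third
   step on, theta_0 and theta_1 having no lower bound, but qhat <= omega / 2 and
   10 eta <= c1^2, so the constants absorb the loss (1 - qhat)^{-3}.  The other two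
   estimates follow from D_k <= L_W/2 |x_k - x*|^2 and |g_k| <= L_W |x_k - x*|. *)

Require Import Defs.
From HB Require Import structures.
From mathcomp Require Import all_boot all_order all_algebra.
From mathcomp Require Import all_classical all_reals all_analysis.
From mathcomp Require Import ring lra.
Import Order.TTheory GRing.Theory Num.Theory.
Import numFieldNormedType.Exports.
Local Open Scope classical_set_scope.
Local Open Scope ring_scope.

(** * Euclidean geometry of row vectors *)

Section Euclidean.
Context {R : realType} {n : nat}.
Implicit Types (u v w : 'rV[R]_n) (a : R).

Lemma dotC u v : dot u v = dot v u.
Proof. by apply: eq_bigr => i _; rewrite mulrC. Qed.

Lemma dotDl u v w : dot (u + v) w = dot u w + dot v w.
Proof. by rewrite -big_split; apply: eq_bigr => i _; rewrite mxE mulrDl. Qed.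

Lemma dotZl a u v : dot (a *: u) v = a * dot u v.
Proof. by rewrite mulr_sumr; apply: eq_bigr => i _; rewrite mxE mulrA. Qed.

Lemma dotDr u v w : dot w (u + v) = dot w u + dot w v.
Proof. by rewrite dotC dotDl !(dotC w). Qed.

Lemma dotZr a u v : dot u (a *: v) = a * dot u v.
Proof. by rewrite dotC dotZl dotC. Qed.

Lemma dotNl u v : dot (- u) v = - dot u v.
Proof. by rewrite -scaleN1r dotZl mulN1r. Qed.

Lemma dotNr u v : dot u (- v) = - dot u v.
Proof. by rewrite dotC dotNl dotC. Qed.

Definition dotE := (dotDl, dotDr, dotNl, dotNr, dotZl, dotZr).

Lemma dot_ge0 u : 0 <= dot u u.
Proof. by apply: sumr_ge0 => i _; rewrite -expr2 sqr_ge0. Qed.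

Lemma dot_eq0 u : dot u u = 0 -> u = 0.
Proof.
move/psumr_eq0P => u0; apply/rowP => i; rewrite mxE.
have /eqP : u ord0 i * u ord0 i = 0 by apply: u0 => // j _; rewrite -expr2 sqr_ge0.
by rewrite mulf_eq0 orbb => /eqP.
Qed.

Lemma dot0l u : dot 0 u = 0.
Proof. by rewrite -(scale0r 0) dotZl mul0r. Qed.

Lemma enorm_ge0 u : 0 <= enorm u.
Proof. exact: sqrtr_ge0. Qed.

Lemma sqr_enorm u : enorm u ^+ 2 = dot u u.
Proof. by rewrite sqr_sqrtr ?dot_ge0. Qed.

Lemma enorm0 : enorm (0 : 'rV[R]_n) = 0.
Proof. by rewrite /enorm dot0l sqrtr0. Qed.

Lemma enorm_eq0 u : enorm u = 0 -> u = 0.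
Proof. by move=> u0; apply: dot_eq0; rewrite -sqr_enorm u0 expr0n. Qed.

Lemma enormZ a u : enorm (a *: u) = `|a| * enorm u.
Proof. by rewrite /enorm !dotE mulrA -expr2 sqrtrM ?sqr_ge0 ?sqrtr_sqr. Qed.

Lemma enormN u : enorm (- u) = enorm u.
Proof. by rewrite /enorm !dotE opprK. Qed.

Lemma enormB u v : enorm (u - v) = enorm (v - u).
Proof. by rewrite -enormN opprB. Qed.

Lemma cauchy_schwarz u v : dot u v <= enorm u * enorm v.
Proof.
have [v0|v0] := eqVneq (dot v v) 0.
  by rewrite (dot_eq0 _ v0) dotC dot0l mulr_ge0 ?enorm_ge0.
have vp : 0 < dot v v by rewrite lt_def v0 dot_ge0.
have := dot_ge0 (dot v v *: u - dot u v *: v).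
rewrite !dotE (dotC v u) => h.
have {}h : 0 <= dot v v * (dot u u * dot v v - dot u v ^+ 2) by lra.
rewrite pmulr_rge0 // subr_ge0 in h.
apply: le_trans (ler_norm _) _.
by rewrite /enorm -sqrtrM ?dot_ge0 // -sqrtr_sqr ler_wsqrtr.
Qed.

Lemma ler_enormD u v : enorm (u + v) <= enorm u + enorm v.
Proof.
rewrite -ler_sqr ?nnegrE ?addr_ge0 ?enorm_ge0 // sqr_enorm sqrrD !sqr_enorm.
by have := cauchy_schwarz u v; rewrite !dotE (dotC v u); lra.
Qed.

Lemma enorm_coord u i : `|u ord0 i| <= enorm u.
Proof.
rewrite -sqrtr_sqr ler_wsqrtr // /dot (bigD1 i) //= expr2 lerDl.
by apply: sumr_ge0 => j _; rewrite -expr2 sqr_ge0.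
Qed.

Lemma enorm_le_norm u : enorm u <= n%:R * `|u|.
Proof.
have hi i : `|u ord0 i| <= `|u|.
  rewrite [leRHS]mx_normrE.
  exact: (le_bigmax _ (fun ij => `|u ij.1 ij.2|) (ord0, i)).
rewrite -ler_sqr ?nnegrE ?mulr_ge0 ?enorm_ge0 // sqr_enorm.
apply: (@le_trans _ _ (\sum_(i < n) `|u| ^+ 2)).
  apply: ler_sum => i _; rewrite -expr2 -real_normK ?num_real //.
  by rewrite ler_sqr ?nnegrE.
rewrite sumr_const card_ord exprMn -[leLHS]mulr_natl ler_wpM2r ?sqr_ge0 //.
by case: n => [|k]; rewrite ?expr0n // ler_eXnr // ler1n.
Qed.

Lemma nbhs_enorm_lt (x : 'rV[R]_n) (d : R) : 0 < d ->
  nbhs x [set y | enorm (y - x) < d].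
Proof.
(* The topology is that of the sup norm, and [enorm] is at most [n] times it. Dividing by [n.+1]
   keeps the radius meaningful for [n = 0]. *)
move=> d0; apply/nbhs_ballP; exists (d / n.+1%:R); first by rewrite /= divr_gt0.
move=> y; rewrite -ball_normE /= distrC ltr_pdivlMr // => yx.
apply: le_lt_trans (enorm_le_norm _) (le_lt_trans _ yx).
by rewrite mulrC ler_wpM2l // ler_nat.
Qed.

Lemma cball0_conv (r t : R) u v : 0 <= t <= 1 ->
  cball0 r u -> cball0 r v -> cball0 r (u + t *: (v - u)).
Proof.
rewrite /cball0 /= => /andP[t0 t1] ur vr.
have -> : u + t *: (v - u) = (1 - t) *: u + t *: v.
  by rewrite scalerBr scalerBl scale1r -addrA [t *: v - _]addrC.
apply: le_trans (ler_enormD _ _) _; rewrite !enormZ ger0_norm ?subr_ge0 // ger0_norm //.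
by nra.
Qed.

End Euclidean.

(** * Restriction to lines and the mean value estimate *)

Section Gradient.
Context {R : realType} {n : nat}.
Variables (f : 'rV[R]_n -> R) (g : 'rV[R]_n -> 'rV[R]_n).
Hypothesis gradf : is_gradient f g.

Lemma is_derive_line x h (t : R) :
  is_derive t 1 (fun s : R => f (x + s *: h)) (dot (g (x + t *: h)) h).
Proof.
have [df dfE] := gradf (x + t *: h).
have hl : is_diff t (fun s : R => x + s *: h) ( *:%R^~ h).
  have := is_diffD (is_diff_cst x t) (is_diff_scalel t h).
  by rewrite add0r.
have hf : is_diff (x + t *: h) f ('d f (x + t *: h)) by exact: DiffDef.
have hc := is_diff_comp hl hf.
have dc : differentiable (f \o (fun s : R => x + s *: h)) t by exact: ex_diff.
apply: DeriveDef; first exact/derivable1_diffP.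
by rewrite -[LHS]/('D_1 (f \o (fun s : R => x + s *: h)) t) deriveE // diff_val /= scale1r dfE.
Qed.

(** Along the segment, [f] minus the quadratic with coefficients [dot (g x) h] and [c / 2] has
    nonnegative derivative, so the mean value theorem compares its endpoints. Asking for the bound
    only when [0 < t] lets users cancel a factor [t]. *)
Lemma gradient_taylor_ge x h (c : R) :
  (forall t, 0 < t < 1 -> c * t <= dot (g (x + t *: h) - g x) h) ->
  f x + dot (g x) h + c / 2 <= f (x + h).
Proof.
move=> hc; pose p (t : R) := f (x + t *: h) - (dot (g x) h * t + c / 2 * t ^+ 2).
pose dp (t : R) := dot (g (x + t *: h)) h - (dot (g x) h + c * t).
have dpP (t : R) : is_derive t 1 p (dp t).
  have h1 := is_derive_line x h t.
  have h2 : is_derive t 1 ((dot (g x) h) *: (id : R -> R) + (c / 2) *: (id ^+ 2 : R -> R))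
      (dot (g x) h + c * t).
    have d2 := is_deriveD (is_deriveZ (dot (g x) h) (is_derive_id t 1))
      (is_deriveZ (c / 2) (is_deriveX 2 (is_derive_id t 1))).
    by apply: (is_derive_eq d2); rewrite /GRing.scale /= expr1; lra.
  have -> : p = (fun s : R => f (x + s *: h)) -
      ((dot (g x) h) *: (id : R -> R) + (c / 2) *: (id ^+ 2 : R -> R)).
    by apply/funext => s; rewrite /p !fctE.
  exact: is_deriveB.
have p01 : {within `[0, 1], continuous p}.
  by apply: derivable_within_continuous => t _; exact: ex_derive.
have [t] := MVT ltr01 (fun t _ => dpP t) p01.
rewrite in_itv /= => t01; rewrite subr0 mulr1 /p /dp scale0r scale1r addr0.
by have := hc t t01; rewrite dotDl dotNl; lra.
Qed.

End Gradient.

(** * Consequences of the gradient and local strong convexity hypotheses *)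

Section GradientConsequences.
Context {R : realType} {n : nat}.
Variables (f : 'rV[R]_n -> R) (g : 'rV[R]_n -> 'rV[R]_n).
Hypothesis gradf : is_gradient f g.

Lemma gradient_taylor_le x h (c : R) :
  (forall t, 0 < t < 1 -> dot (g (x + t *: h) - g x) h <= c * t) ->
  f (x + h) <= f x + dot (g x) h + c / 2.
Proof.
move=> hc.
have gradN : is_gradient (- f) (fun y => - g y).
  move=> y; have [fd df] := gradf y; split; first exact: differentiableN.
  by move=> v; rewrite diffN // !fctE df dotNl.
have := @gradient_taylor_ge _ _ _ _ gradN x h (- c).
rewrite !fctE dotNl => H; suff : - f x - dot (g x) h + - c / 2 <= - f (x + h) by lra.
apply: H => t /hc; rewrite !dotDl !dotNl; lra.
Qed.

(** In the direction [g x] the derivative at 0 is the squared norm of [g x], and 0 is an interior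
    minimum on that line. *)
Lemma gradient_argmin x : argminset f x -> g x = 0.
Proof.
move=> xmin; pose p (s : R) := f (x + s *: g x).
have dp (t : R) : is_derive t 1 p (dot (g (x + t *: g x)) (g x)) by exact: is_derive_line.
have p0 : is_derive (0 : R) 1 p 0.
  apply: (@derive1_at_min _ p (-1) 1); first by lra.
  - by move=> t _; exact: ex_derive.
  - by rewrite in_itv /=; lra.
  - by move=> t _; rewrite /p scale0r addr0; exact: xmin.
have := @derive_val _ _ _ _ _ _ _ p0; rewrite (@derive_val _ _ _ _ _ _ _ (dp 0)).
by rewrite scale0r addr0 => /dot_eq0.
Qed.

End GradientConsequences.

(** * Uniform strong monotonicity of the gradient on balls *)

Section StrongMonotone.
Context {R : realType} {n : nat}.
Variables (f : 'rV[R]_n -> R) (g : 'rV[R]_n -> 'rV[R]_n).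
Hypothesis lsc : locally_strongly_convex f g.

Lemma scale_half_enorm (u : 'rV[R]_n) : enorm (2^-1 *: u) = enorm u / 2.
Proof. by rewrite enormZ ger0_norm ?invr_ge0 // mulrC. Qed.

(** Compactness turns the pointwise radii and moduli into a single [e], which serves both as radius
    and as modulus. Monotonicity comes from adding the strong convexity inequalities for [(y, z)]
    and [(z, y)]. *)
Lemma strongly_monotone_near (r : R) : exists e : R, 0 < e /\
  forall x y z, cball0 r x -> enorm (y - x) < e -> enorm (z - x) < e ->
    e * enorm (y - z) ^+ 2 <= dot (g y - g z) (y - z).
Proof.
(* The cube contains the Euclidean ball and is compact as a product of segments. *)
pose K := [set v : 'rV[R]_n | forall i, `[(- r), r]%classic (v ord0 i)].
have Kc : compact K.
  by apply: (@rV_compact _ _ (fun=> `[(- r), r]%classic)) => _; exact: segment_compact.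
pose P (e : R) (x : 'rV[R]_n) := forall y z, enorm (y - x) < e -> enorm (z - x) < e ->
    e * enorm (y - z) ^+ 2 <= dot (g y - g z) (y - z).
have KP : \forall e \near 0^'+, K `<=` P e.
  move/compact_near_coveringP : Kc; apply => x _.
  have [d [mu [d0 [mu0 hx]]]] := lsc x.
  (* Centres within [d / 2] of [x] and points within [e < d / 2] of such a centre stay within [d] of
     [x]. *)
  exists ([set y | enorm (y - x) < d / 2], [set e : R | 0 < e /\ e < d / 2 /\ e < mu]).
    split; first by apply: nbhs_enorm_lt; rewrite divr_gt0.
    near=> e; split => //; split; near: e; apply: nbhs_right_lt => //.
    by rewrite divr_gt0.
  move=> [x' e] /= [x'x [e0 [ed emu]]] y z yx zx.
  have near_x v : enorm (v - x') < e -> enorm (v - x) < d.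
    move=> vx; have := ler_enormD (v - x') (x' - x).
    by rewrite addrA subrK; lra.
  have := hx y z (near_x _ yx) (near_x _ zx).
  have := hx z y (near_x _ zx) (near_x _ yx).
  rewrite (enormB z y) -(opprB y z) dotNr dotDl dotNl.
  by have := sqr_ge0 (enorm (y - z)); nra.
near (0 : R)^'+ => e.
exists e; split=> // x y z xr; apply: (near KP e) => // i /=.
by rewrite in_itv /= -ler_norml (le_trans (enorm_coord _ _)).
Unshelve. all: by end_near. Qed.

(* Bisecting the segment between two points of the ball doubles, at each step,
   the distance at which the local modulus is valid. *)
Lemma strongly_monotone_ball (r : R) : exists mu : R, 0 < mu /\
  forall y z, cball0 r y -> cball0 r z ->
    mu * enorm (y - z) ^+ 2 <= dot (g y - g z) (y - z).
Proof.
have [e [e0 he]] := strongly_monotone_near r.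
exists e; split=> // y z yr zr.
have [k hk] : exists k, enorm (y - z) < 2 ^+ k * e.
  exists (Num.bound (enorm (y - z) / e)); rewrite -ltr_pdivrMr //.
  apply: lt_le_trans (archi_boundP (divr_ge0 (enorm_ge0 _) (ltW e0))) _.
  by rewrite -natrX ler_nat ltnW // ltn_expl.
elim: k y z yr zr hk => [|k IH] y z yr zr hk.
  rewrite expr0 mul1r in hk.
  by apply: (he z) => //; rewrite subrr enorm0.
(* Both halves are the same vector, so their two inequalities add up to the one for [y] and [z] with
   [e] undiminished. *)
pose m := z + 2^-1 *: (y - z).
have mr : cball0 r m by apply: cball0_conv => //; lra.
have ym : y - m = 2^-1 *: (y - z).
  by apply/rowP => i; rewrite !mxE; lra.
have mz : m - z = 2^-1 *: (y - z) by rewrite /m addrC addKr.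
have := IH y m yr mr; have := IH m z mr zr.
rewrite ym mz !scale_half_enorm !dotE.
rewrite exprS in hk.
have half : enorm (y - z) / 2 < 2 ^+ k * e by lra.
by move=> /(_ half) h1 /(_ half) h2; lra.
Qed.

Hypothesis gradf : is_gradient f g.

Lemma gradient_monotone y z : 0 <= dot (g y - g z) (y - z).
Proof.
have [mu [mu0 hmu]] := strongly_monotone_ball (Num.max (enorm y) (enorm z)).
apply: le_trans (hmu y z _ _); first by rewrite mulr_ge0 ?sqr_ge0 // ltW.
- by rewrite /cball0 /= le_max lexx.
- by rewrite /cball0 /= le_max lexx orbT.
Qed.

Lemma gradient_ineq y z : f y + dot (g y) (z - y) <= f z.
Proof.
have := @gradient_taylor_ge _ _ _ _ gradf y (z - y) 0.
rewrite mul0r addr0 (addrC y) subrK; apply => t /andP[t0 t1].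
have := gradient_monotone (y + t *: (z - y)) y.
by rewrite (addrC y) addrK dotZr mul0r pmulr_rge0.
Qed.

(** Both gradients vanish, so strong monotonicity on a ball containing the two points forces their
    distance to be 0. *)
Lemma argmin_unique x y : argminset f x -> argminset f y -> x = y.
Proof.
move=> /(gradient_argmin _ _ gradf) gx /(gradient_argmin _ _ gradf) gy.
have [mu [mu0 hmu]] := strongly_monotone_ball (Num.max (enorm x) (enorm y)).
have /hmu : cball0 (Num.max (enorm x) (enorm y)) x by rewrite /cball0 /= le_max lexx.
have yr : cball0 (Num.max (enorm x) (enorm y)) y by rewrite /cball0 /= le_max lexx orbT.
move=> /(_ y yr); rewrite gx gy subrr dot0l pmulr_rle0 // => h.
apply/subr0_eq/enorm_eq0/eqP; rewrite -sqrf_eq0 eq_le h sqr_ge0 //.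
Qed.

End StrongMonotone.

(** * Quadratic upper and lower bounds on a ball *)

Section ConvexBall.
Context {R : realType} {n : nat}.
Variables (f : 'rV[R]_n -> R) (g : 'rV[R]_n -> 'rV[R]_n) (r : R).
Hypothesis gradf : is_gradient f g.

Lemma descent_on_ball (L : R) y z : lipschitz_const_on g (cball0 r) L ->
  cball0 r y -> cball0 r z ->
  f z <= f y + dot (g y) (z - y) + L / 2 * dot (z - y) (z - y).
Proof.
move=> lip yr zr.
have := @gradient_taylor_le _ _ _ _ gradf y (z - y) (L * dot (z - y) (z - y)).
rewrite (addrC y) subrK (mulrAC L); apply => t /andP[t0 t1].
apply: le_trans (cauchy_schwarz _ _) _.
have h : cball0 r (y + t *: (z - y)) by apply: cball0_conv => //; lra.
have := lip _ _ h yr.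
rewrite (addrC y) addrK enormZ gtr0_norm // -sqr_enorm => hl.
by have := enorm_ge0 (z - y); nra.
Qed.

Lemma strong_convexity_on_ball (mu : R) y z :
  (forall u v, cball0 r u -> cball0 r v ->
    mu * enorm (u - v) ^+ 2 <= dot (g u - g v) (u - v)) ->
  cball0 r y -> cball0 r z ->
  f y + dot (g y) (z - y) + mu / 2 * dot (z - y) (z - y) <= f z.
Proof.
move=> mon yr zr.
have := @gradient_taylor_ge _ _ _ _ gradf y (z - y) (mu * dot (z - y) (z - y)).
rewrite (addrC y (z - y)) subrK (mulrAC mu); apply => t /andP[t0 t1].
have h : cball0 r (y + t *: (z - y)) by apply: cball0_conv => //; lra.
have := mon _ _ h yr.
rewrite (addrC y) addrK sqr_enorm !dotZr dotZl => hl.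
by rewrite -(ler_pM2l t0); lra.
Qed.

End ConvexBall.

(** * Energy of the adaptive gradient method *)

Section AdaptiveGradientDescent.
Context {R : realType} {n : nat}.
Variables (f : 'rV[R]_n -> R) (g : 'rV[R]_n -> 'rV[R]_n).
Variables (x : nat -> 'rV[R]_n) (s theta : nat -> R) (tau omega : R).
Variable xs : 'rV[R]_n.
Local Notation w := (1 - omega ^+ 2).

Hypothesis gradient_inequality : forall y z, f y + dot (g y) (z - y) <= f z.
Hypothesis f_min : forall y, f xs <= f y.
Hypothesis s0_gt0 : 0 < s 0.
Hypothesis theta0_gt0 : 0 < theta 0.
Hypothesis tau_gt1 : 1 < tau.
Hypothesis omega_gt0 : 0 < omega.
Hypothesis omega_le : omega ^+ 2 <= 1 / 2.
Hypothesis xS : forall k, x k.+1 = x k - s k *: g (x k).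
Hypothesis sS : forall k,
  let A := s k * Num.sqrt (2 * w + theta k / tau) in
  s k.+1 = if Lk g x k == 0 then A else Num.min A (omega / Lk g x k).
Hypothesis thetaS : forall k, theta k.+1 = s k.+1 / s k.

Let sqdist k := dot (x k - xs) (x k - xs).
Let gap k := f (x k) - f xs.
Let sqgrad k := dot (g (x k)) (g (x k)).
Definition energy k := w * sqdist k.+1 + omega ^+ 2 * (s k ^+ 2 * sqgrad k)
  + s k * (2 * w + theta k) * gap k.

Lemma w_gt0 : 0 < w. Proof. by have := omega_le; lra. Qed.

Lemma tau_gt0 : 0 < tau. Proof. exact: lt_trans tau_gt1. Qed.

Lemma gap_ge0 k : 0 <= gap k.
Proof. by rewrite subr_ge0. Qed.

Lemma gradient_mono y z : 0 <= dot (g y - g z) (y - z).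
Proof.
have := gradient_inequality y z; have := gradient_inequality z y.
by rewrite -(opprB y z) !dotE; lra.
Qed.

Lemma xB k : x k.+1 - x k = - (s k *: g (x k)).
Proof. by rewrite xS addrC addKr. Qed.

Lemma Lk_ge0 k : 0 <= Lk g x k.
Proof. by rewrite divr_ge0 ?enorm_ge0. Qed.

Lemma step_theta_gt0 k : 0 < s k /\ 0 < theta k.
Proof.
elim: k => // k [sk tk].
have A0 : 0 < s k * Num.sqrt (2 * w + theta k / tau).
  rewrite mulr_gt0 // sqrtr_gt0; have := w_gt0.
  have : 0 < theta k / tau by rewrite divr_gt0 // tau_gt0.
  lra.
have sk1 : 0 < s k.+1.
  rewrite sS; case: eqVneq => // L0.
  by rewrite lt_min A0 divr_gt0 // lt_def L0 Lk_ge0.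
by split=> //; rewrite thetaS divr_gt0.
Qed.

Lemma step_gt0 k : 0 < s k. Proof. exact: (step_theta_gt0 k).1. Qed.
Lemma theta_gt0 k : 0 < theta k. Proof. exact: (step_theta_gt0 k).2. Qed.

Lemma theta_sqr_le k : theta k.+1 ^+ 2 <= 2 * w + theta k / tau.
Proof.
have sk := step_gt0 k.
have h0 : 0 <= 2 * w + theta k / tau.
  have := w_gt0; have : 0 < theta k / tau by rewrite divr_gt0 ?theta_gt0 ?tau_gt0.
  lra.
rewrite -[leRHS]sqr_sqrtr // ler_sqr ?nnegrE ?sqrtr_ge0 ?(ltW (theta_gt0 _)) //.
rewrite thetaS ler_pdivrMr // mulrC sS; case: ifP => // _.
by rewrite ge_min lexx.
Qed.

(** This is the second entry of the step rule: the gradient difference is [Lk g x k] times the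
    displacement [s k * enorm (g (x k))], and [s k.+1 * Lk g x k <= omega]. *)
Lemma step_curvature k :
  s k.+1 * enorm (g (x k.+1) - g (x k)) <= omega * (s k * enorm (g (x k))).
Proof.
have sk := step_gt0 k.
have [g0|g0] := eqVneq (g (x k)) 0.
  by rewrite xS g0 scaler0 !subr0 g0 enorm0 !mulr0.
have dx : enorm (x k.+1 - x k) = s k * enorm (g (x k)).
  by rewrite xB enormN enormZ gtr0_norm.
have dx0 : 0 < enorm (x k.+1 - x k).
  rewrite dx mulr_gt0 // lt_def enorm_ge0 andbT.
  by apply: contra_neq g0 => /enorm_eq0 ->.
have dg : enorm (g (x k.+1) - g (x k)) = Lk g x k * enorm (x k.+1 - x k).
  by rewrite /Lk divfK ?gt_eqF.
rewrite dg -dx mulrA ler_pM2r // sS; case: eqVneq => [->|L0].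
  by rewrite mulr0 ltW.
have Lp : 0 < Lk g x k by rewrite lt_def L0 Lk_ge0.
by rewrite -ler_pdivlMr // ge_min lexx orbT.
Qed.

(** As [omega ^+ 2 <= 1 / 2], the square root is at least 1, so only the curvature entry can shrink
    the step. *)
Lemma step_incr_or k :
  s k <= s k.+1 \/ 0 < Lk g x k /\ s k.+1 = omega / Lk g x k.
Proof.
have sk := step_gt0 k.
have hA : s k <= s k * Num.sqrt (2 * w + theta k / tau).
  apply: ler_peMr; first exact: ltW.
  rewrite -[leLHS]sqrtr1 ler_wsqrtr //.
  have : 0 < theta k / tau by rewrite divr_gt0 ?theta_gt0 ?tau_gt0.
  by have := omega_le; lra.
rewrite sS; case: eqVneq => [_|L0]; first by left.
have Lp : 0 < Lk g x k by rewrite lt_def L0 Lk_ge0.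
by case: (leP (s k * _) (omega / Lk g x k)) => _; [left|right].
Qed.

Lemma step_le_curvature k : 0 < Lk g x k -> s k.+1 <= omega / Lk g x k.
Proof. by move=> L0; rewrite sS gt_eqF // ge_min lexx orbT. Qed.

(* Expanding [|g_{k+1} - g_k|^2] and using monotonicity in the form
   [<g_{k+1}, g_k> <= |g_k|^2], so that one of the two cross terms is absorbed. *)
Lemma sqgrad_step k : s k.+1 ^+ 2 * sqgrad k.+1 <=
  omega ^+ 2 * (s k ^+ 2 * sqgrad k) + theta k.+1 * s k.+1 * (gap k - gap k.+1).
Proof.
have sk := step_gt0 k; have sk1 := step_gt0 k.+1.
set u := g (x k); set v := g (x k.+1).
have curv : s k.+1 ^+ 2 * dot (v - u) (v - u) <= omega ^+ 2 * (s k ^+ 2 * dot u u).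
  rewrite -!sqr_enorm -!exprMn ler_sqr ?nnegrE ?mulr_ge0 ?enorm_ge0 ?(ltW sk) ?(ltW sk1) ?(ltW omega_gt0) //.
  exact: step_curvature.
have mono : dot v u <= dot u u.
  have := gradient_mono (x k.+1) (x k).
  by rewrite xB dotNr dotZr dotDl dotNl -mulrN pmulr_rge0 // -/u -/v; lra.
have conv : s k * dot v u <= gap k - gap k.+1.
  have := gradient_inequality (x k.+1) (x k).
  by rewrite -(opprB (x k.+1)) xB opprK dotZr /gap -/u -/v; lra.
have -> : theta k.+1 * s k.+1 = s k.+1 ^+ 2 / s k by rewrite thetaS; field; lra.
rewrite -mulrA (mulrC _^-1).
have {}conv : dot v u <= (gap k - gap k.+1) / s k by rewrite ler_pdivlMr // mulrC.
have h := ler_wpM2l (sqr_ge0 (s k.+1)) conv.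
have h' := ler_wpM2l (sqr_ge0 (s k.+1)) mono.
rewrite !dotE (dotC u v) in curv.
by rewrite /sqgrad -/u -/v; lra.
Qed.

Lemma sqdist_step k : sqdist k.+1 =
  sqdist k - 2 * s k * dot (g (x k)) (x k - xs) + s k ^+ 2 * sqgrad k.
Proof.
rewrite /sqdist xS addrAC; move: (x k - xs) => y.
by rewrite !dotE (dotC y) /sqgrad; ring.
Qed.

(** The weights [w] and [omega ^+ 2] of the squared gradient add up to 1, so [sqgrad_step] applies
    to the whole term, and its [gap k.+1] cancels the theta part of the new energy. The first entry
    of the step rule then bounds [theta k.+1 * s k.+1 = s k * theta k.+1 ^+ 2]. *)
Lemma energy_step k :
  energy k.+1 + 2 * w * s k.+1 * (dot (g (x k.+1)) (x k.+1 - xs) - gap k.+1) <=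
  w * sqdist k.+1 + omega ^+ 2 * (s k ^+ 2 * sqgrad k)
    + s k * (2 * w + theta k / tau) * gap k.
Proof.
have sk := step_gt0 k.
have H1 := sqgrad_step k.
have : theta k.+1 * s k.+1 * gap k <= s k * (2 * w + theta k / tau) * gap k.
  apply: ler_wpM2r; first exact: gap_ge0.
  have -> : theta k.+1 * s k.+1 = s k * theta k.+1 ^+ 2.
    by rewrite thetaS; field; lra.
  by rewrite ler_pM2l // theta_sqr_le.
by rewrite /energy (sqdist_step k.+1); lra.
Qed.

Lemma gap_le_dot k : gap k <= dot (g (x k)) (x k - xs).
Proof.
have := gradient_inequality (x k) xs.
by rewrite -(opprB _ xs) dotNr /gap; lra.
Qed.

Lemma energy_noninc k : energy k.+1 <= energy k.
Proof.
have := energy_step k.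
have : 0 <= 2 * w * s k.+1 * (dot (g (x k.+1)) (x k.+1 - xs) - gap k.+1).
  apply: mulr_ge0; last by rewrite subr_ge0; exact: gap_le_dot.
  by rewrite !mulr_ge0 ?(ltW (step_gt0 _)) ?(ltW w_gt0).
have : s k * (2 * w + theta k / tau) * gap k <= s k * (2 * w + theta k) * gap k.
  rewrite ler_wpM2r ?gap_ge0 // ler_pM2l ?step_gt0 // lerD2l.
  by rewrite ler_pdivrMr ?tau_gt0 //; have := theta_gt0 k; have := tau_gt1; nra.
by rewrite /energy; lra.
Qed.

Definition eta0 := sqdist 0 + 2 * (s 0 ^+ 2 * sqgrad 0) + 2 * s 0 * theta 0 * gap 0.

Lemma eta0_ge0 : 0 <= eta0.
Proof.
by rewrite /eta0 !addr_ge0 ?mulr_ge0 ?gap_ge0 ?dot_ge0 ?sqr_ge0 ?(ltW s0_gt0) ?(ltW theta0_gt0).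
Qed.

(** After expanding [sqdist 1], the squared gradient and the theta part of the gap have coefficient
    1, and [1 <= 2 * w] compares them with [w * eta0]. *)
Lemma energy0_le : energy 0 <= w * eta0.
Proof.
have h1 : 0 <= s 0 * (dot (g (x 0)) (x 0 - xs) - gap 0).
  by apply: mulr_ge0; [exact: ltW | rewrite subr_ge0; exact: gap_le_dot].
have h2 : 0 <= s 0 ^+ 2 * sqgrad 0 by rewrite mulr_ge0 ?sqr_ge0 ?dot_ge0.
have h3 : 0 <= s 0 * theta 0 * gap 0 by rewrite !mulr_ge0 ?gap_ge0 // ltW.
have w2 : 0 <= 2 * w - 1 by have := omega_le; lra.
have := mulr_ge0 (ltW w_gt0) h1; have := mulr_ge0 w2 h2; have := mulr_ge0 w2 h3.
by rewrite /energy /eta0 sqdist_step; lra.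
Qed.

Lemma energy_le_eta k : energy k <= w * eta0.
Proof. by elim: k => [|k]; [exact: energy0_le | apply: le_trans; exact: energy_noninc]. Qed.

Lemma sqdist_le_energy k : w * sqdist k.+1 <= energy k.
Proof.
rewrite /energy -addrA lerDl addr_ge0 ?mulr_ge0 ?gap_ge0 ?dot_ge0 ?(ltW omega_gt0) ?(ltW (step_gt0 _)) //.
by have := w_gt0; have := theta_gt0 k; lra.
Qed.

Lemma sqdist_le_eta k : sqdist k <= eta0.
Proof.
case: k => [|k].
  rewrite /eta0 -addrA lerDl.
  by rewrite !addr_ge0 ?mulr_ge0 ?gap_ge0 ?dot_ge0 ?sqr_ge0 ?(ltW s0_gt0) ?(ltW theta0_gt0).
rewrite -(ler_pM2l w_gt0); exact: le_trans (sqdist_le_energy k) (energy_le_eta k).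
Qed.

(** * Linear contraction with the constants of a ball *)

Variables (r L mu : R).
Hypothesis L_gt0 : 0 < L.
Hypothesis mu_gt0 : 0 < mu.
Hypothesis g_xs : g xs = 0.
Hypothesis lipL : lipschitz_const_on g (cball0 r) L.
Hypothesis monoM : forall u v, cball0 r u -> cball0 r v ->
    mu * enorm (u - v) ^+ 2 <= dot (g u - g v) (u - v).
Hypothesis descent : forall y z, cball0 r y -> cball0 r z ->
  f z <= f y + dot (g y) (z - y) + L / 2 * dot (z - y) (z - y).
Hypothesis strong : forall y z, cball0 r y -> cball0 r z ->
  f y + dot (g y) (z - y) + mu / 2 * dot (z - y) (z - y) <= f z.
Hypothesis x_ball : forall k, cball0 r (x k).
Hypothesis xs_ball : cball0 r xs.
Hypothesis xs_shift : forall k, cball0 r (xs + L^-1 *: g (x k)).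

Let smin := Num.min (s 0) (omega / L).
(** Chosen so that [s k.+1 <= omega / mu] gives [kap * s k.+1 <= 1 / (2 * L)], the coefficient that
    cocoercivity pays for. *)
Let kap := mu / (2 * L * omega).
Let full k := energy k + w * kap * (s k ^+ 2 * sqgrad k).

(* Average of the strong convexity bound and of the cocoercivity bound; the
   latter compares [x k] with one gradient step from [xs] for [f - <g (x k), .>]. *)
Lemma coercive k :
  mu / 4 * sqdist k + sqgrad k / (4 * L) <= dot (g (x k)) (x k - xs) - gap k.
Proof.
have L0 := L_gt0; have h1 := strong _ _ (x_ball k) xs_ball.
have h2 := descent _ _ xs_ball (xs_shift k).
have h3 := gradient_inequality (x k) (xs + L^-1 *: g (x k)).
set y := xs + _ in h2 h3.
have yxs : y - xs = L^-1 *: g (x k) by rewrite /y addrC addKr.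
have yxk : y - x k = L^-1 *: g (x k) - (x k - xs).
  by rewrite /y opprB addrCA addrA.
rewrite -(opprB (x k) xs) !dotNr dotNl opprK in h1.
rewrite yxs g_xs dot0l !dotE in h2.
rewrite yxk dotDr dotNr dotZr in h3.
rewrite -/(sqdist k) in h1; rewrite -/(sqgrad k) in h2 h3.
have e2 : L / 2 * (L^-1 * (L^-1 * sqgrad k)) = L^-1 * sqgrad k / 2 by field; lra.
have e3 : sqgrad k / (4 * L) = L^-1 * sqgrad k / 4 by field; lra.
by rewrite e2 in h2; rewrite e3 /gap; lra.
Qed.

Lemma Lk_bounds k : g (x k) <> 0 -> mu <= Lk g x k /\ Lk g x k <= L.
Proof.
move=> gk; have sk := step_gt0 k.
have dx0 : 0 < enorm (x k.+1 - x k).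
  rewrite lt_def enorm_ge0 andbT; apply/negP => /eqP/enorm_eq0.
  rewrite xB => /eqP; rewrite oppr_eq0 scaler_eq0 gt_eqF //= => /eqP; exact: gk.
split; last by rewrite ler_pdivrMr //; exact: lipL.
rewrite ler_pdivlMr // -(ler_pM2r dx0) -mulrA -expr2.
exact: le_trans (monoM _ _ (x_ball _) (x_ball _)) (cauchy_schwarz _ _).
Qed.

Lemma Lk_le k : Lk g x k <= L.
Proof.
have [g0|/eqP g0] := eqVneq (g (x k)) 0; last exact: (Lk_bounds _ g0).2.
(* The iterates coincide, and the quotient by zero takes its default value 0. *)
by rewrite /Lk xB g0 scaler0 oppr0 enorm0 invr0 mulr0 ltW.
Qed.

Lemma smin_gt0 : 0 < smin.
Proof. by rewrite lt_min s0_gt0 divr_gt0. Qed.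

Lemma smin_le k : smin <= s k.
Proof.
elim: k => [|k IH]; first by rewrite ge_min lexx.
have [h|[Lp ->]] := step_incr_or k; first exact: le_trans h.
apply: (@le_trans _ _ (omega / L)); first by rewrite ge_min lexx orbT.
by rewrite ler_pM2l // lef_pV2 ?posrE ?Lk_le.
Qed.

Lemma step_le_omega_mu k : g (x k) <> 0 -> s k.+1 <= omega / mu.
Proof.
move=> /Lk_bounds[h _]; have Lp : 0 < Lk g x k by exact: lt_le_trans h.
apply: le_trans (step_le_curvature _ Lp) _.
by rewrite ler_pM2l // lef_pV2 ?posrE.
Qed.

Lemma kap_gt0 : 0 < kap.
Proof. by rewrite divr_gt0 // !mulr_gt0. Qed.

Lemma full_ge_energy k : energy k <= full k.
Proof.
rewrite lerDl; apply: mulr_ge0; last by rewrite mulr_ge0 ?sqr_ge0 ?dot_ge0.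
by apply: ltW; apply: mulr_gt0; [exact: w_gt0 | exact: kap_gt0].
Qed.

Lemma full_ge0 k : 0 <= full k.
Proof.
apply: le_trans (full_ge_energy k); apply: le_trans (sqdist_le_energy k).
by rewrite mulr_ge0 ?dot_ge0 // ltW // w_gt0.
Qed.

(** A zero gradient places [x k], hence all later iterates, at [xs]. This settles the case in which
    [Lk] carries no curvature information. *)
Lemma stationary_full k : g (x k) = 0 -> full k.+1 = 0.
Proof.
move=> gk.
have xk : x k = xs.
  have := monoM _ _ (x_ball k) xs_ball; rewrite gk g_xs subrr dot0l sqr_enorm pmulr_rle0 // => h.
  by apply/subr0_eq/dot_eq0/eqP; rewrite eq_le h dot_ge0.
have fix_ j : x j = xs -> x j.+1 = xs by move=> xj; rewrite xS xj g_xs scaler0 subr0.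
have xk1 := fix_ _ xk; have xk2 := fix_ _ xk1.
by rewrite /full /energy /sqdist /sqgrad /gap xk2 xk1 g_xs !subrr dot0l; ring.
Qed.

(** The slack in [energy_step] is at least that of [coercive]: its distance part shrinks the
    coefficient of [sqdist k.+1], and its gradient part pays for the term added in [full]. *)
Lemma full_step k : g (x k) <> 0 ->
  full k.+1 <= w * (1 - mu / 2 * s k.+1) * sqdist k.+1
    + omega ^+ 2 * (s k ^+ 2 * sqgrad k) + s k * (2 * w + theta k / tau) * gap k.
Proof.
move=> /step_le_omega_mu sle; have sk := step_gt0 k.+1.
have L0 := L_gt0; have mu0 := mu_gt0; have om0 := omega_gt0.
have := ler_wpM2l (mulr_ge0 (ltW w_gt0) (ltW sk)) (coercive k.+1).
have h : mu / (2 * L * omega) * (s k.+1 ^+ 2 * sqgrad k.+1) <=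
    s k.+1 * sqgrad k.+1 / (2 * L).
  have -> : mu / (2 * L * omega) * (s k.+1 ^+ 2 * sqgrad k.+1) =
      (s k.+1 * sqgrad k.+1 / (2 * L)) * (s k.+1 / (omega / mu)) by field; lra.
  rewrite ler_piMr //; last by rewrite ler_pdivrMr ?mul1r // divr_gt0.
  by rewrite divr_ge0 ?mulr_ge0 ?dot_ge0 ?(ltW sk) ?(ltW L_gt0).
have := ler_wpM2l (ltW w_gt0) h; have := energy_step k.
have -> : sqgrad k.+1 / (4 * L) = sqgrad k.+1 / (2 * L) / 2 by field; lra.
by rewrite /full /kap; lra.
Qed.

Lemma full_le_energy k : full k.+1 <= energy k.
Proof.
have [g0|/eqP g0] := eqVneq (g (x k)) 0.
  rewrite stationary_full //; apply: le_trans (sqdist_le_energy k).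
  by rewrite mulr_ge0 ?dot_ge0 // ltW // w_gt0.
apply: le_trans (full_step _ g0) _.
have : s k * (2 * w + theta k / tau) * gap k <= s k * (2 * w + theta k) * gap k.
  rewrite ler_wpM2r ?gap_ge0 // ler_pM2l ?step_gt0 // lerD2l.
  by rewrite ler_pdivrMr ?tau_gt0 //; have := theta_gt0 k; have := tau_gt1; nra.
have : 0 <= w * (mu / 2 * s k.+1) * sqdist k.+1.
  by rewrite !mulr_ge0 ?dot_ge0 ?invr_ge0 ?(ltW w_gt0) ?(ltW mu_gt0) ?(ltW (step_gt0 _)).
by rewrite /energy; lra.
Qed.

Variable q : R.
Let m := mu * smin / omega.
Hypothesis q_ge0 : 0 <= q.
Hypothesis q_dist : q <= mu / 2 * smin.
Hypothesis q_grad : q * (omega ^+ 2 + w * kap) <= w * kap.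
Hypothesis q_gap : q * (2 * w + m) <= (1 - tau^-1) * m.

Lemma q_le1 : 0 <= 1 - q.
Proof.
have kp := mulr_gt0 w_gt0 kap_gt0; have q0 := mulr_ge0 q_ge0 (sqr_ge0 omega).
by rewrite subr_ge0 -(ler_pM2r kp) mul1r; apply: le_trans q_grad; lra.
Qed.

(* The lower bound [m] on [theta] needs the step two iterations earlier to be
   controlled by the curvature, whence the index shift. *)
Lemma full_contract k : full k.+3 <= (1 - q) * full k.+2.
Proof.
have [g2|/eqP g2] := eqVneq (g (x k.+2)) 0.
  by rewrite stationary_full // mulr_ge0 ?full_ge0 ?q_le1.
have fixg j : g (x j) = 0 -> g (x j.+1) = 0 by move=> gj; rewrite xS gj scaler0 subr0.
have g0 : g (x k) <> 0 by move=> /fixg/fixg.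
have mu0 := mu_gt0; have om0 := omega_gt0; have qg := q_gap; have q0 := q_ge0.
have m_gt0 : 0 < m by rewrite divr_gt0 // mulr_gt0 // smin_gt0.
(* [theta k.+2] is a ratio of steps with numerator at least [smin] and denominator at most
   [omega / mu]. *)
have m_le : m <= theta k.+2.
  rewrite thetaS ler_pdivlMr ?step_gt0 //; apply: le_trans (smin_le k.+2).
  apply: (@le_trans _ _ (m * (omega / mu))).
    by rewrite ler_pM2l //; exact: step_le_omega_mu.
  have -> : m * (omega / mu) = smin; last exact: lexx.
  by rewrite /m; field; rewrite !gt_eqF.
have t1 : 0 < tau^-1 by rewrite invr_gt0 tau_gt0.
(* The gap term needs [q * (2 * w + t) <= (1 - tau^-1) * t] at [t = theta k.+2]. It holds at [t = m]
   by [q_gap], and [q_tau] carries it to every larger [t]. *)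
have q_tau : q <= 1 - tau^-1.
  rewrite -(ler_pM2r m_gt0); apply: le_trans q_gap.
  by rewrite ler_wpM2l //; have := w_gt0; lra.
have Hgap : 2 * w + theta k.+2 / tau <= (1 - q) * (2 * w + theta k.+2) by nra.
have Hdist : w * (1 - mu / 2 * s k.+3) * sqdist k.+3 <= (1 - q) * (w * sqdist k.+3).
  rewrite mulrA ler_wpM2r ?dot_ge0 // mulrC ler_wpM2r ?(ltW w_gt0) //.
  rewrite lerD2l lerN2; apply: le_trans q_dist _.
  by rewrite ler_wpM2l ?smin_le // divr_ge0 // ltW.
have Hgrad : omega ^+ 2 <= (1 - q) * (omega ^+ 2 + w * kap) by have := q_grad; lra.
have := full_step _ g2.
have hN : 0 <= s k.+2 ^+ 2 * sqgrad k.+2 by rewrite mulr_ge0 ?sqr_ge0 ?dot_ge0.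
have hD : 0 <= s k.+2 * gap k.+2 by rewrite mulr_ge0 ?gap_ge0 // ltW ?step_gt0.
have := ler_wpM2r hN Hgrad; have := ler_wpM2r hD Hgap.
by rewrite /full /energy; lra.
Qed.

Lemma sqdist_decay k : sqdist k.+3 <= eta0 * (1 - q) ^+ k.
Proof.
rewrite -(ler_pM2l w_gt0) mulrA.
apply: le_trans (sqdist_le_energy _) (le_trans (full_ge_energy _) _).
elim: k => [|k IH].
  by rewrite expr0 mulr1; apply: le_trans (full_le_energy _) (energy_le_eta _).
apply: le_trans (full_contract k) _.
by rewrite (exprS (1 - q)) mulrCA ler_wpM2l ?q_le1.
Qed.

Lemma sqdist_decay4 k : q <= 36 / 100 -> sqdist k <= 4 * eta0 * (1 - q) ^+ k.
Proof.
move=> q_small; have e0 := eta0_ge0.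
(* The loss of three factors costs at most 4, since the cube of 64/100 exceeds 1/4. Indices below 3
   use the uniform bound by [eta0]. *)
have q3 : 1 <= 4 * (1 - q) ^+ 3.
  have h : 64 / 100 <= 1 - q by lra.
  have h3 : (64 / 100) ^+ 3 <= (1 - q) ^+ 3 by rewrite lerXn2r ?nnegrE //; lra.
  by move: h3; rewrite !(exprS (64 / 100)) expr0; lra.
have q1 : 1 - q <= 1 by have := q_ge0; lra.
have [k3|k3] := ltnP k 3.
  apply: le_trans (sqdist_le_eta k) _.
  rewrite mulrAC ler_peMl //; apply: le_trans q3 _.
  by rewrite ler_pM2l //; apply: ler_wiXn2l => //; [exact: q_le1 | exact: ltnW].
rewrite -(subnK k3) addn3; apply: le_trans (sqdist_decay _) _.
rewrite -(addn3 (k - 3)) exprD.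
have P0 : 0 <= eta0 * (1 - q) ^+ (k - 3) by rewrite mulr_ge0 ?exprn_ge0 ?q_le1.
by have := ler_wpM2l P0 q3; lra.
Qed.

End AdaptiveGradientDescent.

(** * Constants of the statement *)

Section Constants.
Context {R : realType} {n : nat}.
Variables (f : 'rV[R]_n -> R) (g : 'rV[R]_n -> 'rV[R]_n).
Implicit Types (xs : 'rV[R]_n) (r L : R).

Lemma fstar_argmin xs : argminset f xs -> fstar f = f xs.
Proof.
move=> xmin; apply/le_anti/andP; split.
  by apply: ge_inf; [exists (f xs) => _ [y _ <-] | exists xs].
by apply: lb_le_inf; [exists (f xs), xs | move=> _ [y _ <-]].
Qed.

(** Strong convexity makes the set of minimisers a singleton. *)
Lemma setdist_argmin x xs : is_gradient f g -> locally_strongly_convex f g ->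
  argminset f xs -> setdist x (argminset f) = enorm (x - xs).
Proof.
move=> gradf lsc xmin; rewrite /setdist.
have -> : [set enorm (x - z) | z in argminset f] = [set enorm (x - xs)].
  apply/seteqP; split=> [_ [z zmin <-]|_ ->]; last by exists xs.
  by rewrite (argmin_unique _ _ lsc gradf _ _ zmin xmin).
exact: inf1.
Qed.

Lemma muW_strongly_monotone r u v : locally_strongly_convex f g ->
  cball0 r u -> cball0 r v ->
  muW g (cball0 r) * enorm (u - v) ^+ 2 <= dot (g u - g v) (u - v).
Proof.
move=> lsc ur vr; have [->|uv] := eqVneq u v.
  by rewrite subrr enorm0 expr0n mulr0 dotC dot0l.
have uv0 : 0 < enorm (u - v) ^+ 2.
  rewrite exprn_gt0 // lt_def enorm_ge0 andbT.
  by apply: contra_neq uv => /enorm_eq0/subr0_eq.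
rewrite -ler_pdivlMr //; apply: ge_inf.
  exists 0 => _ [y [z [_ [_ [_ ->]]]]].
  by rewrite divr_ge0 ?sqr_ge0 // (@gradient_monotone _ _ f).
by exists v, u; do !split => //; apply/eqP; rewrite eq_sym.
Qed.

(** Makes the set of quotients in [muW] nonempty, so that its infimum is not the default value. *)
Lemma cball0_two_points r : (0 < n)%N -> 0 < r ->
  exists u v : 'rV[R]_n, cball0 r u /\ cball0 r v /\ u <> v.
Proof.
move=> n0 r0; pose e : 'rV[R]_n := const_mx 1.
have e0 : 0 < enorm e.
  rewrite lt_def enorm_ge0 andbT; apply/eqP => /enorm_eq0 /rowP /(_ (Ordinal n0)).
  by rewrite !mxE => /eqP; rewrite oner_eq0.
have re0 : 0 < r / enorm e by rewrite divr_gt0.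
exists 0, ((r / enorm e) *: e); rewrite /cball0 /=; split; first by rewrite enorm0 ltW.
split; first by rewrite enormZ gtr0_norm // divfK // gt_eqF.
move/esym/eqP; rewrite scaler_eq0 gt_eqF //= => /eqP ee.
by move: e0; rewrite ee enorm0 ltxx.
Qed.

Lemma muW_gt0 r : (0 < n)%N -> 0 < r -> locally_strongly_convex f g ->
  0 < muW g (cball0 r).
Proof.
move=> n0 r0 lsc; have [mu [mu0 hmu]] := strongly_monotone_ball _ _ lsc r.
apply: lt_le_trans mu0 _; apply: lb_le_inf.
  have [u [v [ur [vr uv]]]] := cball0_two_points _ n0 r0.
  by eexists; exists u, v; do !split.
move=> _ [u [v [ur [vr [uv ->]]]]].
rewrite ler_pdivlMr; first exact: hmu.
rewrite exprn_gt0 // lt_def enorm_ge0 andbT.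
by apply/eqP => /enorm_eq0/subr0_eq /esym.
Qed.

Lemma muW_le_lipschitz r L : (0 < n)%N -> 0 < r -> locally_strongly_convex f g ->
  lipschitz_const_on g (cball0 r) L -> muW g (cball0 r) <= L.
Proof.
move=> n0 r0 lsc lip; have [u [v [ur [vr uv]]]] := cball0_two_points _ n0 r0.
have uv0 : 0 < enorm (u - v).
  by rewrite lt_def enorm_ge0 andbT; apply/eqP => /enorm_eq0/subr0_eq.
have := muW_strongly_monotone _ _ _ lsc ur vr.
have := cauchy_schwarz (g u - g v) (u - v); have := lip u v ur vr.
move=> h1 h2 h3; rewrite -(ler_pM2r (exprn_gt0 2 uv0)); apply: le_trans h3 _.
by apply: le_trans h2 _; rewrite expr2 mulrA ler_pM2r.
Qed.

End Constants.

(** * Numerical inequalities for the rate and the constants *)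

Lemma ler_sqr_rate {R : rcfType} (a c p : R) (k : nat) : 0 <= c -> 0 <= p ->
  a ^+ 2 <= c ^+ 2 * p ^+ k -> a <= c * Num.sqrt p ^+ k.
Proof.
move=> c0 p0 h; have [a0|a0] := leP 0 a; last first.
  by apply: le_trans (ltW a0) _; rewrite mulr_ge0 ?exprn_ge0 ?sqrtr_ge0.
rewrite -ler_sqr ?nnegrE ?mulr_ge0 ?exprn_ge0 ?sqrtr_ge0 //.
by rewrite exprMn -exprM mulnC exprM sqr_sqrtr.
Qed.

Lemma rate_bounds {R : realType} (omega tau mu L s0 : R) :
  0 < omega -> omega ^+ 2 <= 1 / 2 -> 1 < tau -> 0 < mu -> mu <= L -> 0 < s0 ->
  let w := 1 - omega ^+ 2 in
  let smin := Num.min s0 (omega / L) in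
  let m := Num.min (s0 * mu / omega) (mu / L) in
  let q := Num.min (Num.min (mu / 2 * smin) (mu * w / (2 * omega ^+ 3 * L + mu * w)))
             ((tau - 1) * m / (tau * (2 * w + m))) in
  [/\ 0 <= q, q <= 36 / 100, q <= mu / 2 * smin,
      q * (omega ^+ 2 + w * (mu / (2 * L * omega))) <= w * (mu / (2 * L * omega)) &
      q * (2 * w + mu * smin / omega) <= (1 - tau^-1) * (mu * smin / omega)].
Proof.
move=> om0 om2 tau1 mu0 mu_le s0_gt0 w smin m q.
have L0 : 0 < L by exact: lt_le_trans mu_le.
have smin0 : 0 < smin by rewrite lt_min s0_gt0 divr_gt0.
have w0 : 0 < w by rewrite /w; lra.
(* Factoring [mu / omega] out of the minimum identifies the [m] of the statement with the lower
   bound used for theta. *)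
have mE : m = mu * smin / omega.
  rewrite /smin mulrAC minr_pMr ?divr_ge0 ?(ltW mu0) ?(ltW om0) //.
  by rewrite /m; congr Num.min; field; rewrite !gt_eqF.
have m0 : 0 < m by rewrite mE divr_gt0 // mulr_gt0.
have den2 : 0 < 2 * omega ^+ 3 * L + mu * w by rewrite addr_gt0 ?mulr_gt0 ?exprn_gt0.
have den3 : 0 < 2 * w + m by rewrite addr_gt0 ?mulr_gt0.
have tau0 : 0 < tau by exact: lt_trans tau1.
have q_dist : q <= mu / 2 * smin by rewrite !ge_min lexx.
rewrite -mE; split=> //.
- rewrite !le_min -andbA; apply/and3P; split.
  + by rewrite mulr_ge0 ?(ltW smin0) // divr_ge0 // ltW.
  + by rewrite divr_ge0 ?(ltW den2) // mulr_ge0 // ltW.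
  + by apply: divr_ge0; apply: mulr_ge0; rewrite ?subr_ge0; exact: ltW.
(* The first entry of the minimum is at most [omega / 2], because [mu <= L] and
   [smin <= omega / L]. *)
- have om_lt : omega <= 72 / 100 by nra.
  have h : mu / 2 * smin <= L / 2 * (omega / L).
    apply: ler_pM; rewrite ?(ltW smin0) ?divr_ge0 ?(ltW mu0) //; first lra.
    by rewrite ge_min lexx orbT.
  have e : L / 2 * (omega / L) = omega / 2 by field; rewrite gt_eqF.
  by lra.
- have : q <= mu * w / (2 * omega ^+ 3 * L + mu * w) by rewrite !ge_min lexx orbT.
  rewrite ler_pdivlMr // => h.
  (* Dividing the cleared second entry by [2 * L * omega] gives the gradient condition. *)
  have lo : 0 < (2 * L * omega)^-1 by rewrite invr_gt0 !mulr_gt0.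
  have := ler_wpM2r (ltW lo) h.
  by congr (_ <= _); field; rewrite !gt_eqF.
- have : q <= (tau - 1) * m / (tau * (2 * w + m)) by rewrite ge_min lexx orbT.
  rewrite ler_pdivlMr ?mulr_gt0 // mulrCA mulrC -ler_pdivlMr // => /le_trans; apply.
  have -> : (tau - 1) * m / tau = (1 - tau^-1) * m; last exact: lexx.
  by field; rewrite gt_eqF.
Qed.

(** With [mu <= L] and [d <= omega ^+ 2], the claim reduces to [2 * omega * eta <= c], which
    [10 * eta <= c] covers as [omega <= 1]. *)
Lemma gap_constant_le {R : realType} (omega mu L eta c d : R) :
  0 < omega -> omega ^+ 2 <= 1 / 2 -> 0 < mu -> mu <= L -> 0 <= eta -> 10 * eta <= c ->
  0 < d -> d <= omega ^+ 2 -> L / 2 * (4 * eta) <= omega * L ^+ 2 * c / (mu * d).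
Proof.
move=> om0 om2 mu0 mu_le eta0 c_ge d0 d_le.
have L0 : 0 < L by exact: lt_le_trans mu_le.
rewrite ler_pdivlMr ?mulr_gt0 //.
have h1 : 0 <= L / 2 * (4 * eta) by rewrite mulr_ge0 ?mulr_ge0 ?(ltW L0).
apply: le_trans (ler_wpM2l h1 (ler_pM (ltW mu0) (ltW d0) mu_le d_le)) _.
have h2 : 0 <= omega * L ^+ 2 by rewrite mulr_ge0 ?sqr_ge0 ?(ltW om0).
have h3 : 0 <= 1 - omega by nra.
have := ler_wpM2l h2 c_ge; have := mulr_ge0 h2 eta0.
by have := mulr_ge0 h3 (mulr_ge0 h2 eta0); lra.
Qed.

Lemma gradient_constant_le {R : realType} (omega mu L eta c d : R) :
  0 < omega -> omega ^+ 2 <= 1 / 2 -> 0 < mu -> mu <= L -> 0 <= eta ->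
  10 * eta <= c ^+ 2 -> 0 < d -> d <= omega ->
  L ^+ 2 * (4 * eta) <= (Num.sqrt (2 * c ^+ 2 * (1 - omega ^+ 2) * omega * L ^+ 3) /
    (Num.sqrt (2 * omega ^+ 2 * L + (1 - omega ^+ 2) * mu) * d)) ^+ 2.
Proof.
move=> om0 om2 mu0 mu_le eta0 c_ge d0 d_le.
have L0 : 0 < L by exact: lt_le_trans mu_le.
have w0 : 0 < 1 - omega ^+ 2 by lra.
have D0 : 0 < 2 * omega ^+ 2 * L + (1 - omega ^+ 2) * mu.
  by rewrite addr_gt0 ?mulr_gt0 ?exprn_gt0.
rewrite expr_div_n exprMn (sqr_sqrtr (ltW D0)) sqr_sqrtr; last first.
  apply: mulr_ge0; last by rewrite exprn_ge0 // ltW.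
  by apply: mulr_ge0; [apply: mulr_ge0; [exact: mulr_ge0 (sqr_ge0 c)|] |]; exact: ltW.
rewrite ler_pdivlMr ?mulr_gt0 ?exprn_gt0 //.
(* Replacing [mu] by [L] gives [(1 + omega ^+ 2) * L]. What remains after cancellation is [6 * eta *
   omega <= 2 * c ^+ 2 * (1 - omega ^+ 2)]. *)
have hD : 2 * omega ^+ 2 * L + (1 - omega ^+ 2) * mu <= 3 / 2 * L.
  by have := ler_wpM2l (ltW w0) mu_le; have := ler_wpM2r (ltW L0) om2; lra.
have hd : d ^+ 2 <= omega ^+ 2 by rewrite ler_sqr ?nnegrE ?(ltW d0) ?(ltW om0).
have L2e : 0 <= L ^+ 2 * (4 * eta) by rewrite mulr_ge0 ?sqr_ge0 ?mulr_ge0.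
apply: le_trans (ler_wpM2l L2e (ler_pM (ltW D0) (sqr_ge0 d) hD hd)) _.
have P0 : 0 <= omega * L ^+ 3 by rewrite mulr_ge0 ?exprn_ge0 ?(ltW om0) ?(ltW L0).
have -> : L ^+ 2 * (4 * eta) * (3 / 2 * L * omega ^+ 2) =
  omega * L ^+ 3 * (6 * eta * omega) by field.
have -> : 2 * c ^+ 2 * (1 - omega ^+ 2) * omega * L ^+ 3 =
  omega * L ^+ 3 * (2 * c ^+ 2 * (1 - omega ^+ 2)) by ring.
rewrite ler_wpM2l //.
have w2 : 0 <= 1 / 2 - omega ^+ 2 by lra.
have o1 : 0 <= 1 - omega by nra.
by have := mulr_ge0 (sqr_ge0 c) w2; have := mulr_ge0 eta0 o1; lra.
Qed.

Theorem theorem4p6 (R : realType) (n : nat)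
  (f : 'rV[R]_n -> R) (g : 'rV[R]_n -> 'rV[R]_n)
  (x : nat -> 'rV[R]_n) (alpha theta gamma : nat -> R)
  (tau omega gmin gmax Rad LW : R) (xstar : 'rV[R]_n) :
  (* assumptions on f; g is the gradient of f *)
  convexf f -> is_gradient f g -> continuous g ->
  locally_strongly_convex f g -> locally_lipschitz g ->
  argminset f !=set0 ->
  (* parameters *)
  0 < alpha 0 -> 0 < theta 0 -> 1 < tau ->
  0 < omega -> omega <= 1 / Num.sqrt 2 ->
  0 < gmin -> gmin <= gmax ->
  (forall k, gmin <= gamma k <= gmax) ->
  (* the iteration *)
  (forall k, x k.+1 = x k - (alpha k * gamma k) *: g (x k)) ->
  (forall k, alpha k.+1 =
     next_alpha omega tau (alpha k) (gamma k) (theta k) (gamma k.+1) (Lk g x k)) ->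
  (forall k, theta k.+1 = alpha k.+1 * gamma k.+1 / (alpha k * gamma k)) ->
  let fs := fstar f in
  let d0 := setdist (x 0) (argminset f) in
  let eta := d0 ^+ 2 + 2 * (alpha 0) ^+ 2 * (gamma 0) ^+ 2 * enorm (g (x 0)) ^+ 2
             + 2 * alpha 0 * gamma 0 * theta 0 * (f (x 0) - fs) in
  Rad > 3 * Num.sqrt eta + d0 + enorm (x 0) ->
  0 < LW -> lipschitz_const_on g (cball0 Rad) LW ->
  let mu := muW g (cball0 Rad) in
  let m := Num.min (alpha 0 * gamma 0 * mu / omega) (mu / LW) in
  let qhat := Num.min (Num.min
                (mu / 2 * Num.min (alpha 0 * gamma 0) (omega / LW))
                (mu * (1 - omega ^+ 2) /
                   (2 * omega ^+ 3 * LW + mu * (1 - omega ^+ 2))))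
                ((tau - 1) * m / (tau * (2 * (1 - omega ^+ 2) + m))) in
  argminset f xstar ->
  let c1 := Num.sqrt ((Rad + enorm (x 0)) ^+ 2 + eta) in
  let c2 := omega * LW ^+ 2 * c1 ^+ 2 /
            (mu * Num.min ((alpha 0) ^+ 2 * (gamma 0) ^+ 2 * LW ^+ 2) (omega ^+ 2)) in
  let c3 := Num.sqrt (2 * c1 ^+ 2 * (1 - omega ^+ 2) * omega * LW ^+ 3) /
            (Num.sqrt (2 * omega ^+ 2 * LW + (1 - omega ^+ 2) * mu) *
             Num.min (alpha 0 * gamma 0 * LW) omega) in
  forall k : nat,
    enorm (x k.+1 - xstar) <= c1 * Num.sqrt (1 - qhat) ^+ k /\
    f (x k) - fs <= c2 * (1 - qhat) ^+ k /\
    enorm (g (x k)) <= c3 * Num.sqrt (1 - qhat) ^+ k.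
Proof.
move=> _ gradf _ lsc _ _ alpha0_gt0 theta0_gt0 tau1 om0 om_le gmin0 _ gammaP xS alphaS thetaS.
move=> fs d0 eta Rad_gt LW0 lip mu m q xmin c1 c2 c3 k.
have gamma0 j : 0 < gamma j by have /andP[h _] := gammaP j; exact: lt_le_trans h.
have om2 : omega ^+ 2 <= 1 / 2.
  have s2 : 0 < Num.sqrt (2 : R) by rewrite sqrtr_gt0.
  have h : omega * Num.sqrt 2 <= 1 by rewrite -ler_pdivlMr.
  have := ler_pM (mulr_ge0 (ltW om0) (ltW s2)) (mulr_ge0 (ltW om0) (ltW s2)) h h.
  by rewrite -expr2 exprMn sqr_sqrtr //; lra.
have fsE : fs = f xstar by exact: fstar_argmin.
have d0E : d0 = enorm (x 0 - xstar) by exact: (@setdist_argmin _ _ f g).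
pose s j := alpha j * gamma j.
have s0_gt0 : 0 < s 0 by exact: mulr_gt0.
have f_min : forall y, f xstar <= f y by exact: xmin.
have etaE : eta = eta0 f g x s theta xstar.
  rewrite /eta /eta0 d0E fsE !sqr_enorm /s; ring.
have eta_ge0 : 0 <= eta by rewrite etaE; exact: eta0_ge0.
have c1_ge0 : 0 <= c1 by exact: sqrtr_ge0.
have c1_sqr : c1 ^+ 2 = (Rad + enorm (x 0)) ^+ 2 + eta.
  by rewrite sqr_sqrtr // addr_ge0 ?sqr_ge0.
have d0_ge0 : 0 <= d0 by rewrite d0E enorm_ge0.
have x0_ge0 := enorm_ge0 (x 0); have se_ge0 := sqrtr_ge0 eta.
have Rad0 : 0 < Rad by lra.
have c3_ge0 : 0 <= c3.
  rewrite divr_ge0 ?sqrtr_ge0 // mulr_ge0 ?sqrtr_ge0 // le_min (ltW om0) andbT.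
  by rewrite mulr_ge0 ?(ltW LW0) ?(ltW s0_gt0).
(* In dimension 0 no two points are distinct, so [mu] is the infimum of the empty set, 0 by default.
   Then [c2] is 0 as well, and all three left-hand sides vanish. *)
have [n0|n_gt0] := posnP n.
  have triv (u : 'rV[R]_n) : u = 0.
    apply/rowP => i; have : (0 < n)%N by exact: leq_ltn_trans (ltn_ord i).
    by rewrite lt0n => /eqP.
  have mu0 : mu = 0.
    rewrite -(inf0 R) /mu /muW; congr inf.
    apply/seteqP; split=> // r [u [v [_ [_ [uv _]]]]].
    by case: uv; rewrite (triv u) (triv v).
  have q1 : 0 <= 1 - q.
    suff : q <= 0 by lra.
    by rewrite /q mu0 !mul0r !ge_min lexx.
  rewrite (triv (x k.+1 - xstar)) (triv (g (x k))) enorm0 fsE (triv xstar) (triv (x k)).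
  rewrite subrr /c2 mu0 !mul0r invr0 mulr0 mul0r lexx.
  by split; [|split] => //; apply: mulr_ge0 => //; rewrite exprn_ge0 ?sqrtr_ge0.
have mu0 : 0 < mu by exact: (@muW_gt0 _ _ f).
have mu_le : mu <= LW by exact: (@muW_le_lipschitz _ _ f).
have mono u v := @muW_strongly_monotone _ _ f g Rad u v lsc.
have g_ineq := gradient_ineq f g lsc gradf.
have g_xs : g xstar = 0 by exact: (gradient_argmin f).
(* Multiplying the rule for [alpha] by [gamma j.+1] cancels the scaling and leaves a recursion in
   [s] alone. *)
have sS j : let A := s j * Num.sqrt (2 * (1 - omega ^+ 2) + theta j / tau) in
    s j.+1 = if Lk g x j == 0 then A else Num.min A (omega / Lk g x j).
  move=> A; rewrite {1}/s alphaS /next_alpha.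
  have gj := gamma0 j.+1; case: eqVneq => L0.
    by rewrite /A /s; field; lra.
  rewrite minr_pMl ?(ltW gj) //; congr Num.min.
    by rewrite /A /s; field; lra.
  by field; rewrite L0 gt_eqF.
have thS j : theta j.+1 = s j.+1 / s j by exact: thetaS.
(* This bound rests on global convexity and precedes the ball constants, so deriving [x_ball] from
   it is not circular. *)
have dist_eta j : dot (x j - xstar) (x j - xstar) <= eta.
  rewrite etaE; exact: (sqdist_le_eta _ _ _ _ _ _ _ _ g_ineq f_min s0_gt0 theta0_gt0 tau1 om0).
have dist_sqrt j : enorm (x j - xstar) <= Num.sqrt eta by rewrite ler_wsqrtr.
have xs_norm : enorm xstar <= d0 + enorm (x 0).
  rewrite d0E enormB; have := ler_enormD (xstar - x 0) (x 0).
  by rewrite subrK.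
have xs_ball : cball0 Rad xstar by rewrite /cball0 /=; lra.
have x_ball j : cball0 Rad (x j).
  rewrite /cball0 /=; have := ler_enormD (x j - xstar) xstar; rewrite subrK.
  by have := dist_sqrt j; lra.
have g_le j : enorm (g (x j)) <= LW * enorm (x j - xstar).
  by have := lip _ _ (x_ball j) xs_ball; rewrite g_xs subr0.
(* By the Lipschitz bound the shift is no longer than the distance from [x j] to [xstar], hence at
   most [Num.sqrt eta], which the radius accommodates. *)
have xs_shift j : cball0 Rad (xstar + LW^-1 *: g (x j)).
  rewrite /cball0 /=; have := ler_enormD xstar (LW^-1 *: g (x j)).
  have : enorm (LW^-1 *: g (x j)) <= enorm (x j - xstar).
    by rewrite enormZ gtr0_norm ?invr_gt0 // mulrC ler_pdivrMr // mulrC.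
  by have := dist_sqrt j; lra.
have desc y z := @descent_on_ball _ _ f g Rad gradf LW y z lip.
have strong y z := @strong_convexity_on_ball _ _ f g Rad gradf mu y z mono.
have rb := rate_bounds _ _ _ _ _ om0 om2 tau1 mu0 mu_le s0_gt0.
have q_ge0 : 0 <= q by case: rb.
have q_small : q <= 36 / 100 by case: rb.
have [_ _ q_dist q_grad q_gap] := rb.
have decay j : dot (x j - xstar) (x j - xstar) <= 4 * eta * (1 - q) ^+ j.
  rewrite etaE.
  exact: (sqdist_decay4 _ _ _ _ _ _ _ _ g_ineq f_min s0_gt0 theta0_gt0 tau1 om0 om2 xS sS thS
    _ _ _ LW0 mu0 g_xs lip mono desc strong x_ball xs_ball xs_shift).
have q1 : 0 <= 1 - q by lra.
(* The radius contributes [(3 * Num.sqrt eta) ^+ 2], that is [9 * eta], and the second summand of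
   [c1 ^+ 2] contributes one more [eta]. *)
have c1_eta : 10 * eta <= c1 ^+ 2.
  rewrite c1_sqr; have h : 3 * Num.sqrt eta <= Rad + enorm (x 0) by lra.
  have := ler_pM (mulr_ge0 (ler0n _ 3) se_ge0) (mulr_ge0 (ler0n _ 3) se_ge0) h h.
  by rewrite -!expr2 exprMn sqr_sqrtr //; lra.
have qk j : 0 <= (1 - q) ^+ j by exact: exprn_ge0.
split; last split.
- apply: ler_sqr_rate => //; rewrite sqr_enorm.
  apply: le_trans (decay k.+1) _; rewrite exprS.
  have := qk k; have h := mulr_ge0 q_ge0 (mulr_ge0 eta_ge0 (qk k)).
  have := ler_wpM2r (qk k) c1_eta; have := mulr_ge0 eta_ge0 (qk k); lra.
- have gap_le : f (x k) - fs <= LW / 2 * (4 * eta * (1 - q) ^+ k).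
    have := desc _ _ xs_ball (x_ball k); rewrite g_xs dot0l addr0 fsE.
    have L2 : 0 <= LW / 2 by lra.
    by have := ler_wpM2l L2 (decay k); lra.
  apply: le_trans gap_le _; rewrite mulrA ler_wpM2r //.
  apply: gap_constant_le => //; last by rewrite ge_min lexx orbT.
  by rewrite lt_min !mulr_gt0 ?exprn_gt0.
- apply: ler_sqr_rate => //.
  have g_sqr : enorm (g (x k)) ^+ 2 <= LW ^+ 2 * (4 * eta * (1 - q) ^+ k).
    apply: le_trans (_ : LW ^+ 2 * enorm (x k - xstar) ^+ 2 <= _).
      by rewrite -exprMn ler_sqr ?nnegrE ?mulr_ge0 ?enorm_ge0 ?(ltW LW0).
    by rewrite sqr_enorm ler_wpM2l ?sqr_ge0.
  apply: le_trans g_sqr _; rewrite mulrA ler_wpM2r //.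
  apply: gradient_constant_le => //; last by rewrite ge_min lexx orbT.
  by rewrite lt_min om0 !mulr_gt0.
Qed.
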